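(* Given an ovaloid $S\subset\mathbb{R}^3_1$, there is a translation $T:\mathbb{R}^3_1\to\mathbb{R}^3_1$ such that $i_M(T(S))$ is an ovaloid.
   Context: The Minkowski 3-space $\mathbb{R}^3_1$ is $\mathbb{R}^3$ with the pseudo-scalar product $\langle u,v\rangle = u_0v_0+u_1v_1-u_2v_2$. The light cone is $LC=\{p : \langle p,p\rangle=0\}$. The Möbius inversion of a closed subset $F\subset\mathbb{R}^3_1$ is $i_M(F)=cl\{p/\langle p,p\rangle : p\in F\setminus LC\}$, where $cl$ is the closure in the usual (Euclidean) topology of $\mathbb{R}^3$. Surfaces are smooth regular surfaces in $\mathbb{R}^3$; a closed surface is one that is compact, connected and without boundary. A surface $S$ has contact $A_1^+$ with its tangent plane $T_pS$ at $p\in S$ if the height function on $S$ along a normal direction to $T_pS$ (e.g. $q\mapsto (q-p)\cdot\nu$ with $\nu\neq0$ Euclidean-orthogonal to $T_pS$) has a Morse (non-degenerate) singularity of index $0$ or $2$ at $p$. A closed surface $S$ is an ovaloid if it is strictly convex, that is, it has contact $A_1^+$ with $T_pS$ at $p$ for all $p\in S$. This notion does not depend on the metric (Euclidean or Lorentzian) on $\mathbb{R}^3$. *)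

(* Defs.v *)
From HB Require Import structures.
From mathcomp Require Import all_boot all_order all_algebra.
From mathcomp Require Import all_classical all_reals all_analysis.

Set Implicit Arguments.
Unset Strict Implicit.
Unset Printing Implicit Defensive.

Import Order.TTheory GRing.Theory Num.Theory.
Import numFieldNormedType.Exports.

Local Open Scope classical_set_scope.
Local Open Scope ring_scope.

(* The norm of 'rV[R]_n is the sup norm; it induces the Euclidean topology. *)

Section Smooth.
Variables (R : realType) (V W : normedModType R).

(* To be used with U open and V finite-dimensional, where it is the usual
   class C^k. *)
Fixpoint Ck_on (k : nat) (U : set V) (f : V -> W) : Prop :=
  if k is k'.+1 then
    (forall u, U u -> differentiable f u) /\
    (forall v, Ck_on k' U (fun u => 'D_v f u))
  else forall u, U u -> {for u, continuous f}.

Definition smooth_on (U : set V) (f : V -> W) : Prop :=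
  forall k, Ck_on k U f.

End Smooth.

Section Morse.
Variables (R : realType) (n : nat).

Definition hessian (f : 'rV[R]_n.+1 -> R) (u : 'rV[R]_n.+1) : 'M[R]_n.+1 :=
  \matrix_(i, j)
    'D_(delta_mx 0 i) (fun w : 'rV[R]_n.+1 => 'D_(delta_mx 0 j) f w) u.

Definition negative_definite_on (H : 'M[R]_n.+1)
    (E : {vspace 'rV[R]_n.+1}) : Prop :=
  forall v, v \in E -> v != 0 -> (v *m H *m v^T) 0 0 < 0.

(* k is the largest dimension of a subspace on which H is negative definite *)
Definition has_index (H : 'M[R]_n.+1) (k : nat) : Prop :=
  (exists2 E, negative_definite_on H E & \dim E = k) /\
  (forall E, negative_definite_on H E -> (\dim E <= k)%N).

Definition morse_singularity (f : 'rV[R]_n.+1 -> R) (u : 'rV[R]_n.+1)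
    (k : nat) : Prop :=
  [/\ forall v, 'D_v f u = 0,
      hessian f u \in unitmx
    & has_index (hessian f u) k].

End Morse.

Section Surfaces.
Variable R : realType.
Implicit Types (S : set 'rV[R]_3) (U : set 'rV[R]_2) (x : 'rV[R]_2 -> 'rV[R]_3).

(* The last two conditions say that x is a homeomorphism from U onto a
   relatively open subset of S; only the values of x on U matter. *)
Definition local_parametrization S U x : Prop :=
  [/\ open U,
      smooth_on U x,
      forall u, U u -> injective ('d x u),
      set_inj U x
    & forall O, open O -> O `<=` U ->
        exists2 V : set 'rV[R]_3, open V & x @` O = S `&` V].

Definition regular_surface S : Prop :=
  forall p, S p ->
    exists U x, local_parametrization S U x /\ (x @` U) p.

Definition closed_surface S : Prop :=
  [/\ regular_surface S, S !=set0, compact S & connected S].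

(* the linear tangent plane: velocities at p of smooth curves drawn on S *)
Definition tangent_plane S (p : 'rV[R]_3) : set 'rV[R]_3 :=
  [set v | exists (c : R^o -> 'rV[R]_3) (e : R),
     [/\ 0 < e, smooth_on [set` `]-e, e[] c,
         forall t, t \in `]-e, e[ -> S (c t), c 0 = p & 'D_1 c 0 = v]].

Definition dot (u v : 'rV[R]_3) : R := \sum_i u 0 i * v 0 i.

Definition normal_direction S (p nu : 'rV[R]_3) : Prop :=
  nu != 0 /\ forall v, tangent_plane S p v -> dot v nu = 0.

Definition height (p nu q : 'rV[R]_3) : R := dot (q - p) nu.

(* Being a Morse singularity, and its index, do not depend on the local
   parametrization used to read the restriction of h to S. *)
Definition morse_singularity_on S (h : 'rV[R]_3 -> R) (p : 'rV[R]_3)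
    (k : nat) : Prop :=
  exists U x u, [/\ local_parametrization S U x, U u, x u = p
                  & morse_singularity (h \o x) u k].

(* Multiplying nu by a negative scalar exchanges the indices 0 and 2. *)
Definition contact_A1plus S (p : 'rV[R]_3) : Prop :=
  exists2 nu, normal_direction S p nu &
    morse_singularity_on S (height p nu) p 0 \/
    morse_singularity_on S (height p nu) p 2.

Definition ovaloid S : Prop :=
  closed_surface S /\ forall p, S p -> contact_A1plus S p.

End Surfaces.

Section Minkowski.
Variable R : realType.

Definition mink (u v : 'rV[R]_3) : R :=
  u 0 0 * v 0 0 + u 0 1 * v 0 1 - u 0 2%:R * v 0 2%:R.

Definition light_cone : set 'rV[R]_3 := [set p | mink p p = 0].

Definition moebius_inversion (F : set 'rV[R]_3) : set 'rV[R]_3 :=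
  closure ((fun p => (mink p p)^-1 *: p) @` (F `\` light_cone)).

Definition translation (a p : 'rV[R]_3) : 'rV[R]_3 := p + a.

End Minkowski.

(* Main.v *)
(** Write <u, v> for the pseudo-scalar product and i(p) = p / <p, p>, which is an
    involution off the light cone.  Let x be a local parametrization of S, nu a
    Euclidean normal vector, and q = x + a.  Planes through i(q) pull back under
    i to pseudospheres through q, so the height function of i(S + a) along its
    normal at i(q) is, up to the factor 1 / <q, q>, the restriction to S + a of
    the equation of the tangent pseudosphere.  Its Hessian is therefore
      (1 / <q, q>) (nu . x_ij + 2 (nu . q / <q, q>) <x_i, x_j>),
    the second fundamental form of S plus a correction.  For a = e / s with e
    not null, the correction is O(s) as s tends to 0, uniformly on the compact
    set S, and S + a avoids the light cone; since the second fundamental form is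
    definite, so is the new Hessian once s is small. *)

From HB Require Import structures.
Require Import Defs.
From mathcomp Require Import all_boot all_order all_algebra.
From mathcomp Require Import all_classical all_reals all_analysis.
From mathcomp Require Import ring lra.

Set Implicit Arguments.
Unset Strict Implicit.
Unset Printing Implicit Defensive.

Import Order.TTheory GRing.Theory Num.Theory.
Import numFieldNormedType.Exports.

Local Open Scope classical_set_scope.
Local Open Scope ring_scope.

(** * Calculus of maps of class C^k *)

(** The first-order expansion of [f] at [x] only sees values near [x], so it is also one of [g];
    uniqueness of the differential identifies its linear part as ['d g x]. *)
Lemma near_eq_differentiable (R : realType) (V W : normedModType R)
    (f g : V -> W) (x : V) :
  (\near x, f x = g x) -> differentiable f x -> differentiable g x.
Proof.
move=> fg df.
have gE : g \o shift x = cst (g x) + 'd f x +o_ 0 id.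
  apply/eqaddoE/eqaddoP => e e0.
  have /eqaddoP /(_ e e0) := diff_locally df.
  have : \forall h \near (0 : V), f (h + x) = g (h + x).
    by move: fg; rewrite (near_shift 0) /=; apply: filterS => h /=; rewrite subr0.
  have fgx := nbhs_singleton fg.
  apply: filterS2 => h /= E.
  by rewrite !fctE /= E fgx.
apply/diff_locallyP; rewrite (diff_unique (diff_continuous df) gE).
by split; [exact: diff_continuous|exact: gE].
Qed.

Lemma continuous_rVP (R : realType) (T : topologicalType) (n : nat)
    (f : T -> 'rV[R]_n) u :
  {for u, continuous f} <-> forall j, {for u, continuous (fun x => f x 0 j)}.
Proof.
split=> [cf j|cf A [P MP sPA]].
  apply: (@continuous_comp _ _ _ f (fun N : 'rV[R]_n => N 0 j)) => //.
  exact: coord_continuous.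
have : \forall x \near u, forall j, P 0 j (f x 0 j).
  by apply: filter_forall => j; exact: cf j _ (MP 0 j).
by apply: filterS => x Px; apply: sPA => i j; rewrite ord1.
Qed.

Section Ck.
Context {R : realType} {V : normedModType R}.
Implicit Types (U : set V).

(** Continuity, differentiability and derivatives at a point of an open set depend only on values in
    that set. This allows a derivative to be replaced by a formula valid only on [U]. *)
Lemma Ck_on_eq (W : normedModType R) (k : nat) U (f g : V -> W) : open U ->
  (forall u, U u -> f u = g u) -> Ck_on k U f -> Ck_on k U g.
Proof.
move=> Uo; elim: k f g => [|k IH] f g fg.
  move=> cf u Uu; rewrite /prop_for /continuous_at /= -(fg u Uu).
  apply: cvg_trans (cf u Uu); apply: near_eq_cvg.
  by apply: filterS (open_nbhs_nbhs (conj Uo Uu)) => z /fg.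
have nfg u : U u -> \near u, f u = g u.
  by move=> Uu; apply: filterS (open_nbhs_nbhs (conj Uo Uu)) => z /fg.
move=> [df Df]; split => [u Uu|v].
  by apply: near_eq_differentiable (df u Uu); exact: nfg.
apply: IH (Df v) => u Uu; apply: near_eq_derive; exact: nfg.
Qed.

Lemma Ck_onW (W : normedModType R) (k : nat) U (f : V -> W) :
  Ck_on k.+1 U f -> Ck_on k U f.
Proof.
elim: k f => [|k IH] f [df Df]; first by move=> u Uu; exact/differentiable_continuous/df.
by split => // v; apply: IH.
Qed.

Lemma Ck_on_cst (W : normedModType R) (k : nat) U (a : W) :
  Ck_on k U (fun=> a).
Proof.
elim: k a => [|k IH] a; first by move=> u _; exact: cst_continuous.
split => [u _|v]; first exact: differentiable_cst.
have -> : (fun u => 'D_v (fun=> a) u) = (fun=> 0 : W); last exact: IH.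
by apply/funext => u; rewrite derive_cst.
Qed.

Lemma Ck_onD (W : normedModType R) (k : nat) U (f g : V -> W) : open U ->
  Ck_on k U f -> Ck_on k U g -> Ck_on k U (fun u => f u + g u).
Proof.
move=> Uo; elim: k f g => [|k IH] f g.
  by move=> cf cg u Uu; apply: cvgD; [exact: cf|exact: cg].
move=> [df Df] [dg Dg]; split => [u Uu|v].
  by apply: differentiableD; [exact: df|exact: dg].
apply: Ck_on_eq (IH _ _ (Df v) (Dg v)) => // u Uu /=.
by rewrite -deriveD //; apply: diff_derivable; [exact: df|exact: dg].
Qed.

Lemma Ck_onM (k : nat) U (f g : V -> R) : open U ->
  Ck_on k U f -> Ck_on k U g -> Ck_on k U (fun u => f u * g u).
Proof.
move=> Uo; elim: k f g => [|k IH] f g.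
  by move=> cf cg u Uu; apply: cvgM; [exact: cf|exact: cg].
move=> Cf Cg; have [df Df] := Cf; have [dg Dg] := Cg; split => [u Uu|v].
  by apply: differentiableM; [exact: df|exact: dg].
have CD := Ck_onD Uo (IH _ _ (Ck_onW Cf) (Dg v)) (IH _ _ (Ck_onW Cg) (Df v)).
apply: (Ck_on_eq Uo _ CD) => u Uu /=.
by rewrite -[RHS]/('D_v (f * g) u) deriveM //; apply: diff_derivable;
  [exact: df|exact: dg].
Qed.

(** Induction through the derivative of 1/f, namely -f'/f^2: its factor 1/f is of class C^k by the
    induction hypothesis. *)
Lemma Ck_onV (k : nat) U (f : V -> R) : open U ->
  (forall u, U u -> f u != 0) ->
  Ck_on k U f -> Ck_on k U (fun u => (f u)^-1).
Proof.
move=> Uo f0; elim: k => [|k IH].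
  by move=> cf u Uu; apply: cvgV; [exact: f0|exact: cf].
move=> Cf; have [df Df] := Cf; split => [u Uu|v].
  by apply: differentiableV; [exact: df|exact: f0].
have Ci := IH (Ck_onW Cf).
have CD := Ck_onM Uo (Ck_onM Uo (Ck_on_cst k U (-1 : R)) (Df v)) (Ck_onM Uo Ci Ci).
apply: (Ck_on_eq Uo _ CD) => u Uu /=.
rewrite deriveV; [|exact: f0|exact/diff_derivable/df].
by rewrite /GRing.scale /= -exprVn; ring.
Qed.

Lemma differentiable_rVP (n : nat) (f : V -> 'rV[R]_n) u :
  differentiable f u <-> forall j, differentiable (fun u => f u 0 j) u.
Proof.
split=> [df j|df].
  apply: (@differentiable_comp _ _ _ _ f (fun N : 'rV[R]_n => N 0 j)) => //.
  exact: differentiable_coord.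
rewrite (_ : f = \sum_j (fun u => f u 0 j *: delta_mx 0 j : 'rV[R]_n)).
  by apply: differentiable_sum => j; exact: differentiableZl.
by apply/funext => w; rewrite fct_sumE -row_sum_delta.
Qed.

Lemma derive_coord (n : nat) (f : V -> 'rV[R]_n) u v j :
  differentiable f u -> 'D_v (fun w => f w 0 j) u = ('D_v f u) 0 j.
Proof. by move=> df; rewrite derive_mx ?mxE //; exact: diff_derivable. Qed.

Lemma Ck_on_rVP (n k : nat) U (f : V -> 'rV[R]_n) : open U ->
  Ck_on k U f <-> forall j, Ck_on k U (fun u => f u 0 j).
Proof.
move=> Uo; elim: k f => [|k IH] f.
  split=> [cf j u Uu|cf u Uu]; first by move: j; apply/continuous_rVP; exact: cf.
  by apply/continuous_rVP => j; exact: cf.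
split=> [[df Df] j|Cf].
  split => [u Uu|v]; first by move: j; apply/differentiable_rVP; exact: df.
  apply: (Ck_on_eq Uo _ ((IH _).1 (Df v) j)) => u Uu.
  by rewrite derive_coord //; exact: df.
have df u : U u -> differentiable f u.
  by move=> Uu; apply/differentiable_rVP => j; have [+ _] := Cf j; apply.
split=> // v; apply/IH => j; have [_ /(_ v)] := Cf j.
by apply: (Ck_on_eq Uo) => u Uu; rewrite derive_coord //; exact: df.
Qed.

End Ck.

(** * Symmetry of second derivatives *)

Section Schwarz.
Context {R : realType} {V : normedModType R}.

Lemma is_derive_line (W : normedModType R) (f : V -> W) (x v : V) (t : R) :
  derivable f (x + t *: v) v ->
  is_derive t 1 (fun t => f (x + t *: v)) ('D_v f (x + t *: v)).
Proof.
have E : (fun h : R => h^-1 *: (f (x + (h *: 1 + t) *: v) - f (x + t *: v))) =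
         (fun h : R => h^-1 *: (f (h *: v + (x + t *: v)) - f (x + t *: v))).
  by apply/funext => h; rewrite [h *: 1]mulr1 scalerDl addrCA.
by move=> df; split; rewrite /derivable /derive ?E.
Qed.

Lemma growth_rate_translate (W : normedModType R) (f : V -> W) (a x v : V) :
  (fun h : R => h^-1 *: (f (h *: v + x + a) - f (x + a))) =
  (fun h : R => h^-1 *: (f (h *: v + (x + a)) - f (x + a))).
Proof. by apply/funext => h; rewrite addrA. Qed.

Lemma derive_translate (W : normedModType R) (f : V -> W) (a x v : V) :
  'D_v (fun y => f (y + a)) x = 'D_v f (x + a).
Proof. by rewrite /derive growth_rate_translate. Qed.

Lemma derivable_translate (W : normedModType R) (f : V -> W) (a x v : V) :
  derivable f (x + a) v -> derivable (fun y => f (y + a)) x v.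
Proof. by rewrite /derivable -growth_rate_translate. Qed.

Lemma MVT_line (f : V -> R) (x v : V) (s : R) : 0 < s ->
  (forall t, 0 <= t <= s -> derivable f (x + t *: v) v) ->
  exists2 t, 0 <= t <= s & f (x + s *: v) - f x = s * 'D_v f (x + t *: v).
Proof.
move=> s0 df.
have dl t : 0 <= t <= s -> is_derive t 1 (fun t => f (x + t *: v)) ('D_v f (x + t *: v)).
  by move=> /df; exact: is_derive_line.
have [t||t ts] := @MVT R (fun t => f (x + t *: v)) (fun t => 'D_v f (x + t *: v)) 0 s s0.
- by rewrite in_itv /= => /andP[/ltW t0 /ltW ts]; apply: dl; rewrite t0.
- apply: derivable_within_continuous => t; rewrite in_itv /= => ts.
  by have [] := dl t ts.
rewrite scale0r addr0 subr0 mulrC => ->; exists t => //.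
by move: ts; rewrite in_itv /= => /andP[/ltW -> /ltW ->].
Qed.

(** Two applications of the mean value theorem: to y -> f(y + s w) - f(y) along [v], then to
    ['D_v f] along [w]. *)
Lemma second_difference (f : V -> R) (u v w : V) (s : R) : 0 < s ->
  (forall a b, 0 <= a <= s -> 0 <= b <= s ->
    derivable f (u + a *: v + b *: w) v /\
    derivable ('D_v f) (u + a *: v + b *: w) w) ->
  exists a b, [/\ 0 <= a <= s, 0 <= b <= s &
    f (u + s *: v + s *: w) - f (u + s *: v) - (f (u + s *: w) - f u) =
    s * (s * 'D_w ('D_v f) (u + a *: v + b *: w))].
Proof.
move=> s0 df; have s1 : 0 <= s <= s by rewrite lexx ltW.
have s2 : 0 <= (0 : R) <= s by rewrite lexx ltW.
have df0 a : 0 <= a <= s -> derivable f (u + a *: v) v.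
  by move=> /df /(_ s2)[]; rewrite scale0r addr0.
have dfs a : 0 <= a <= s -> derivable (fun y => f (y + s *: w)) (u + a *: v) v.
  by move=> /df /(_ s1)[? _]; exact: derivable_translate.
have [a a_s E] : exists2 a, 0 <= a <= s &
    f (u + s *: v + s *: w) - f (u + s *: v) - (f (u + s *: w) - f u) =
    s * ('D_v f (u + a *: v + s *: w) - 'D_v f (u + a *: v)).
  have [a ha|a a_s ->] := @MVT_line (fun y => f (y + s *: w) - f y) u v s s0.
    by apply: derivableB; [exact: dfs|exact: df0].
  exists a => //; rewrite deriveB ?derive_translate //; [exact: dfs|exact: df0].
have [b /(df _ _ a_s)[] //|b b_s Eb] := @MVT_line ('D_v f) (u + a *: v) w s s0.
by exists a, b; rewrite E Eb.
Qed.

(** The second difference of [f] is symmetric in [v] and [w]. Hence the two mixed derivatives take a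
    common value at two points of an arbitrarily small parallelogram at [u], and continuity makes
    them agree at [u]. *)
Lemma Schwarz (U : set V) (f : V -> R) (u v w : V) : open U -> U u ->
  Ck_on 2 U f -> 'D_v ('D_w f) u = 'D_w ('D_v f) u.
Proof.
move=> Uo Uu [df Df].
have cD v' w' : {for u, continuous ('D_v' ('D_w' f))}.
  by have [_ /(_ v')] := Df w'; apply.
apply/eqP; rewrite -subr_eq0 -normr_le0; apply/ler_addgt0Pr => e e0; rewrite add0r.
have gap (s A B X Y : R) : 0 < s -> s * (s * X) = s * (s * Y) ->
    `|B - X| < e / 2 -> `|A - Y| < e / 2 -> `|A - B| <= e.
  move=> s0 E h1 h2; have sn : s != 0 by rewrite gt_eqF.
  rewrite -(subrKA Y) (le_trans (ler_normD _ _)) // [leRHS]splitr.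
  by rewrite lerD // ltW // distrC -(mulfI sn (mulfI sn E)).
have e2 : 0 < e / 2 by rewrite divr_gt0.
have : \forall y \near u, [/\ U y, `|'D_v ('D_w f) u - 'D_v ('D_w f) y| < e / 2
    & `|'D_w ('D_v f) u - 'D_w ('D_v f) y| < e / 2].
  have /cvgrPdist_lt /(_ _ e2) c1 := cD v w.
  have /cvgrPdist_lt /(_ _ e2) c2 := cD w v.
  have c3 : \forall y \near u, U y by exact: open_nbhs_nbhs.
  by apply: filterS3 c1 c2 c3 => y h1 h2 h3; exact: And3 h3 h1 h2.
move=> /nbhs_normP[r /= r0 rP].
(* With this [s] the parallelogram spanned by s v and s w lies in the ball of radius [r]; the
   summand 1 keeps the denominator positive and the inclusion strict. *)
pose s := r / (`|v| + `|w| + 1).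
have p0 : 0 < `|v| + `|w| + 1 by rewrite ltr_wpDl // addr_ge0.
have s0 : 0 < s by rewrite divr_gt0.
(* The pair is only constrained by its norm sum, so that the bound serves for (v, w) and for (w,
   v). *)
have P v' w' a b : `|v'| + `|w'| = `|v| + `|w| -> 0 <= a <= s -> 0 <= b <= s ->
    [/\ U (u + a *: v' + b *: w'),
      `|'D_v ('D_w f) u - 'D_v ('D_w f) (u + a *: v' + b *: w')| < e / 2
    & `|'D_w ('D_v f) u - 'D_w ('D_v f) (u + a *: v' + b *: w')| < e / 2].
  move=> vw /andP[a0 a_s] /andP[b0 b_s]; apply: rP; rewrite /= /ball_ /=.
  rewrite -addrA opprD addrA subrr sub0r normrN.
  apply: (@le_lt_trans _ _ (s * (`|v'| + `|w'|))).
    rewrite (le_trans (ler_normD _ _)) // !normrZ !ger0_norm // mulrDr.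
    by rewrite lerD // ler_wpM2r.
  rewrite vw -[ltRHS](divfK (lt0r_neq0 p0)) -/s ltr_pM2l //.
  by rewrite ltrDl.
have [|a [b [ha hb E1]]] := @second_difference f u v w s s0.
  move=> a b ha hb; have [Uy _ _] := P v w a b erefl ha hb; split.
    exact/diff_derivable/df.
  by apply: diff_derivable; have [+ _] := Df v; apply.
have [|c [d [hc hd E2]]] := @second_difference f u w v s s0.
  move=> a' b' ha' hb'; have [|Uy _ _] := P w v a' b' _ ha' hb'; first exact: addrC.
  split; first exact/diff_derivable/df.
  by apply: diff_derivable; have [+ _] := Df w; apply.
have [_ _ h1] := P v w a b erefl ha hb.
have [|_ h2 _] := P w v c d _ hc hd; first exact: addrC.
have E : f (u + s *: v + s *: w) - f (u + s *: v) - (f (u + s *: w) - f u) =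
         f (u + s *: w + s *: v) - f (u + s *: w) - (f (u + s *: v) - f u).
  by rewrite (addrAC u (s *: w)); ring.
exact: (gap _ _ _ _ _ s0 (etrans (esym E1) (etrans E E2)) h1 h2).
Qed.

End Schwarz.

(** * Definite binary quadratic forms *)

Section Forms.
Context {R : realType}.
Implicit Types (H : 'M[R]_2) (v : 'rV[R]_2).

(* Four times the determinant of the symmetric part: it is positive exactly
   when the quadratic form is definite, of either sign. *)
Definition disc H : R := 4 * (H 0 0 * H 1 1) - (H 0 1 + H 1 0) ^+ 2.

Lemma qformE H v : (v *m H *m v^T) 0 0 =
  H 0 0 * v 0 0 ^+ 2 + (H 0 1 + H 1 0) * (v 0 0 * v 0 1) + H 1 1 * v 0 1 ^+ 2.
Proof.
rewrite !mxE !big_ord_recl !big_ord0 !mxE !big_ord_recl !big_ord0.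
rewrite (_ : lift ord0 ord0 = 1); last exact/val_inj.
by rewrite (_ : ord0 = 0) //; ring.
Qed.

Definition row2 (a b : R) : 'rV[R]_2 := \row_j (if j == 0 then a else b).

Lemma row2_eq0 (v : 'rV[R]_2) : v 0 0 = 0 -> v 0 1 = 0 -> v = 0.
Proof.
move=> v0 v1; apply/rowP => j; rewrite mxE.
by case: j => [[|[|//]] jlt]; [rewrite -[RHS]v0|rewrite -[RHS]v1];
  congr (v 0 _); exact/val_inj.
Qed.

Lemma row2_neq0 (a b : R) : b != 0 -> row2 a b != 0.
Proof. by apply: contra => /eqP /rowP /(_ 1); rewrite !mxE /= => ->. Qed.

Lemma dim_rV2 : \dim {: 'rV[R]_2} = 2%N.
Proof. by rewrite dimvf /dim /=. Qed.

Lemma det_mx22 H : \det H = H 0 0 * H 1 1 - H 0 1 * H 1 0.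
Proof.
rewrite (expand_det_row _ ord0) !big_ord_recl big_ord0 /cofactor !det_mx11 !mxE.
have -> : lift ord0 ord0 = 1 :> 'I_2 by exact/val_inj.
have -> : lift 1 0 = 0 :> 'I_2 by exact/val_inj.
by rewrite /= (_ : ord0 = 0) //; ring.
Qed.

(** Index 0 makes the form nonnegative, since a vector of negative value would span a negative
    definite line; invertibility then makes the discriminant strictly positive. Index 2 makes it
    negative definite on the whole plane. *)
Lemma disc_gt0_of_index H : H 0 1 = H 1 0 -> H \in unitmx ->
  has_index H 0 \/ has_index H 2 -> 0 < disc H.
Proof.
move=> Hs; rewrite unitmxE unitfE det_mx22 -Hs => Hd.
have qE a b : (row2 a b *m H *m (row2 a b)^T) 0 0 =
    H 0 0 * a ^+ 2 + 2 * H 0 1 * (a * b) + H 1 1 * b ^+ 2.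
  by rewrite qformE !mxE /= -Hs; ring.
have -> : disc H = 4 * (H 0 0 * H 1 1 - H 0 1 * H 0 1) by rewrite /disc -Hs; ring.
rewrite pmulr_rgt0 //.
case=> [[_ H0]|[[E Eneg dE] _]].
  have q_ge0 v : 0 <= (v *m H *m v^T) 0 0.
    rewrite leNgt; apply/negP => qv.
    have v0 : v != 0 by apply: contraTneq qv => ->; rewrite mul0mx mul0mx mxE ltxx.
    have /H0 : negative_definite_on H <[v]>%VS.
      move=> w /vlineP[k ->] kv0.
      have k0 : k != 0 by apply: contraNneq kv0 => ->; rewrite scale0r.
      have -> : (k *: v *m H *m (k *: v)^T) 0 0 = k ^+ 2 * (v *m H *m v^T) 0 0.
        by rewrite linearZ /= -scalemxAr -!scalemxAl !mxE; ring.
      by rewrite pmulr_rlt0 // exprn_even_gt0.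
    by rewrite dim_vline v0.
  have a_ge0 : 0 <= H 0 0 by have := q_ge0 (row2 1 0); rewrite qE; lra.
  have [a0|a_neq0] := eqVneq (H 0 0) 0.
    (* Writing a, b, c for the entries [H 0 0], [H 0 1], [H 1 1]: when a = 0 the form takes the
       value -4 b^2 at this vector, which forces b = 0. *)
    have := q_ge0 (row2 (- (H 1 1 + 1)) (2 * H 0 1)); rewrite qE a0 => h.
    have : 0 <= - (H 0 1 ^+ 2) by lra.
    rewrite oppr_ge0 => h2; have b0 : H 0 1 = 0.
      by apply/eqP; rewrite -[_ == _](sqrf_eq0); rewrite eq_le h2 sqr_ge0.
    by move: Hd; rewrite a0 b0 !mul0r subrr eqxx.
  have a_gt0 : 0 < H 0 0 by rewrite lt_def a_neq0.
  rewrite lt_def Hd -(pmulr_rge0 _ a_gt0).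
  (* At (-b, a) the form equals a (a c - b^2), that is a times the determinant; the same vector
     serves in the negative definite case. *)
  by have := q_ge0 (row2 (- H 0 1) (H 0 0)); rewrite qE => h; lra.
have q_lt0 v : v != 0 -> (v *m H *m v^T) 0 0 < 0.
  apply: Eneg; rewrite (_ : E = fullv) ?memvf //.
  by apply/eqP; rewrite eqEdim subvf dE dim_rV2.
have a_lt0 : H 0 0 < 0.
  have r10 : row2 1 0 != 0.
    by apply/eqP => /rowP /(_ 0); rewrite !mxE /= => /eqP; rewrite oner_eq0.
  by have := q_lt0 _ r10; rewrite qE; lra.
have := q_lt0 _ (row2_neq0 (- H 0 1) (ltr0_neq0 a_lt0)); rewrite qE => h.
by rewrite -(nmulr_rlt0 _ a_lt0); lra.
Qed.

(** Completing the square gives 4 a q(v) = (2 a v0 + (b + b') v1)^2 + disc v1^2, where b and b' are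
    the off-diagonal entries, so [q] has the strict sign of a = [H 0 0] away from 0. *)
Lemma index_of_disc_gt0 H : 0 < disc H ->
  H \in unitmx /\ (has_index H 0 \/ has_index H 2).
Proof.
move=> dH; split.
  rewrite unitmxE unitfE det_mx22; apply: contraTneq dH => d0.
  (* The discriminant is 4 times the determinant minus a square, so a zero determinant would make it
     nonpositive. *)
  rewrite -leNgt (_ : disc H =
      4 * (H 0 0 * H 1 1 - H 0 1 * H 1 0) - (H 0 1 - H 1 0) ^+ 2).
    by rewrite d0 mulr0 sub0r oppr_le0 sqr_ge0.
  by rewrite /disc; ring.
have a_neq0 : H 0 0 != 0.
  apply: contraTneq dH => a0; rewrite -leNgt /disc a0 mul0r mulr0 sub0r.
  by rewrite oppr_le0 sqr_ge0.
have sq_gt0 v : v != 0 -> 0 < H 0 0 * (v *m H *m v^T) 0 0.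
  move=> v0; rewrite -(@pmulr_rgt0 _ 4) // qformE.
  rewrite (_ : 4 * _ =
      (2 * H 0 0 * v 0 0 + (H 0 1 + H 1 0) * v 0 1) ^+ 2 + disc H * v 0 1 ^+ 2).
    have [v1|v1] := eqVneq (v 0 1) 0.
      rewrite v1 mulr0 addr0 expr0n mulr0 addr0 exprn_even_gt0 //=.
      rewrite !mulf_neq0 //; apply: contra v0 => /eqP v00.
      by apply/eqP/row2_eq0.
    by rewrite ltr_wpDl ?sqr_ge0 // mulr_gt0 // exprn_even_gt0.
  by rewrite /disc; ring.
have [a_lt0|a_gt0|a0] := ltgtP (H 0 0) 0; last by rewrite a0 eqxx in a_neq0.
  right; split.
    exists fullv; last exact: dim_rV2.
    by move=> v _ /sq_gt0; rewrite nmulr_rgt0.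
  by move=> E _; apply: leq_trans (dimvS (subvf E)) _; rewrite dim_rV2.
left; split; first by exists 0%VS; [move=> v; rewrite memv0 => ->|exact: dimv0].
move=> E En; rewrite leqn0 dimv_eq0 -vpick0; apply: contraT => v0.
have := En _ (memv_pick E) v0.
by have := sq_gt0 _ v0; rewrite pmulr_rgt0 // => /ltW; rewrite leNgt => /negbTE ->.
Qed.

End Forms.

(** * Vectors of Minkowski 3-space *)

Section Algebra.
Context {R : realType}.
Implicit Types (p q u v w m n : 'rV[R]_3).

Lemma forall_I3 (P : 'I_3 -> Prop) : P 0 -> P 1 -> P 2%:R -> forall i, P i.
Proof.
move=> P0 P1 P2 [[|[|[|//]]] jlt].
- by rewrite (_ : Ordinal _ = 0) //; exact/val_inj.
- by rewrite (_ : Ordinal _ = 1) //; exact/val_inj.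
- by rewrite (_ : Ordinal _ = 2%:R) //; exact/val_inj.
Qed.

Lemma rV3P u v : u 0 0 = v 0 0 -> u 0 1 = v 0 1 -> u 0 2%:R = v 0 2%:R -> u = v.
Proof. by move=> h0 h1 h2; apply/rowP; exact: forall_I3. Qed.

Lemma dotE u v : dot u v = u 0 0 * v 0 0 + u 0 1 * v 0 1 + u 0 2%:R * v 0 2%:R.
Proof.
rewrite /dot !big_ord_recl big_ord0 addr0 addrA.
have -> : lift ord0 ord0 = 1 :> 'I_3 by exact/val_inj.
by have -> : lift ord0 (lift ord0 ord0) = 2%:R :> 'I_3 by exact/val_inj.
Qed.

Definition row3 (a b c : R) : 'rV[R]_3 :=
  \row_j (if j == 0 then a else if j == 1 then b else c).

Definition cross u v : 'rV[R]_3 :=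
  row3 (u 0 1 * v 0 2%:R - u 0 2%:R * v 0 1)
       (u 0 2%:R * v 0 0 - u 0 0 * v 0 2%:R)
       (u 0 0 * v 0 1 - u 0 1 * v 0 0).

(** This is the Gram matrix of the pseudo-scalar product acting on vectors: it exchanges Euclidean
    and Lorentzian normals. *)
Definition flip v : 'rV[R]_3 := row3 (v 0 0) (v 0 1) (- v 0 2%:R).

Lemma row30 a b c : row3 a b c 0 0 = a. Proof. by rewrite mxE. Qed.
Lemma row31 a b c : row3 a b c 0 1 = b. Proof. by rewrite mxE. Qed.
Lemma row32 a b c : row3 a b c 0 2%:R = c. Proof. by rewrite mxE. Qed.
Definition row3E := (row30, row31, row32).

Lemma dot_flip u v : dot u (flip v) = mink u v.
Proof. by rewrite dotE !row3E /mink; ring. Qed.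

Lemma mink_flip u v : mink (flip u) v = dot v u.
Proof. by rewrite dotE /mink !row3E; ring. Qed.

Lemma flip_eq0 v : flip v = 0 -> v = 0.
Proof.
move=> v0; apply: rV3P; rewrite !mxE.
- by have := congr1 (fun w : 'rV_3 => w 0 0) v0; rewrite row3E mxE.
- by have := congr1 (fun w : 'rV_3 => w 0 1) v0; rewrite row3E mxE.
- have := congr1 (fun w : 'rV_3 => w 0 2%:R) v0; rewrite row3E mxE.
  by move/eqP; rewrite oppr_eq0 => /eqP.
Qed.

Lemma minkC u v : mink u v = mink v u.
Proof. by rewrite /mink; ring. Qed.

Lemma minkDl u v w : mink (u + v) w = mink u w + mink v w.
Proof. by rewrite /mink !mxE; ring. Qed.

Lemma minkZl (k : R) u v : mink (k *: u) v = k * mink u v.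
Proof. by rewrite /mink !mxE; ring. Qed.

Lemma minkZr (k : R) u v : mink u (k *: v) = k * mink u v.
Proof. by rewrite /mink !mxE; ring. Qed.

Lemma dotZl (k : R) u v : dot (k *: u) v = k * dot u v.
Proof. by rewrite !dotE !mxE; ring. Qed.

Lemma dotBl u v w : dot (u - v) w = dot u w - dot v w.
Proof. by rewrite !dotE !mxE; ring. Qed.

(** From the Cramer identity det(w, u, v) n = (w . n) u x v + (u . n) v x w + (v . n) w x u, whose
    right side vanishes while [n] does not. *)
Lemma coplanar_cross u v w n : n != 0 ->
  dot u n = 0 -> dot v n = 0 -> dot w n = 0 -> dot w (cross u v) = 0.
Proof.
move=> n0 un vn wn; apply/eqP; apply: contra_neqT n0 => d0.
have E k : dot w (cross u v) * n 0 k = dot w n * cross u v 0 k +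
    dot u n * cross v w 0 k + dot v n * cross w u 0 k -> n 0 k = 0.
  by rewrite un vn wn !mul0r !addr0 => /eqP; rewrite mulf_eq0 (negPf d0) => /eqP.
by apply: rV3P; rewrite [RHS]mxE; apply: E; rewrite !dotE !row3E; ring.
Qed.

Lemma proportional_combination u v k :
  (forall i, u 0 k * v 0 i = u 0 i * v 0 k) -> - v 0 k *: u + u 0 k *: v = 0.
Proof. by move=> E; apply/rowP => i; rewrite !mxE E; ring. Qed.

(** By the expansion of a double cross product, the difference of the two sides is a combination of
    u . n and v . n. It serves to trade an arbitrary normal for the cross product of the chart
    velocities. *)
Lemma dot_normal u v w n : dot u n = 0 -> dot v n = 0 ->
  dot (cross u v) (cross u v) * dot w n = dot (cross u v) n * dot w (cross u v).
Proof.
move=> un vn; apply/eqP; rewrite -subr_eq0; apply/eqP.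
transitivity (dot v n * dot w (cross (cross u v) u)
    - dot u n * dot w (cross (cross u v) v)).
  by rewrite !dotE !row3E; ring.
by rewrite un vn !mul0r subr0.
Qed.

Lemma dot_self_eq0 v : (dot v v == 0) = (v == 0).
Proof.
apply/idP/eqP => [|->]; last by rewrite dotE !mxE !mulr0 !addr0.
rewrite dotE -!expr2 => h.
have [h0 [h1 h2]]: v 0 0 ^+ 2 = 0 /\ v 0 1 ^+ 2 = 0 /\ v 0 2%:R ^+ 2 = 0.
  move: h; rewrite !paddr_eq0 ?addr_ge0 ?sqr_ge0 //.
  by move=> /andP[/andP[/eqP -> /eqP ->] /eqP ->].
by apply: rV3P; rewrite mxE; apply/eqP; rewrite -[_ == _]sqrf_eq0; apply/eqP.
Qed.

(** Total by the convention that 0 has inverse 0: null vectors are sent to 0. *)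
Definition minv p : 'rV[R]_3 := (mink p p)^-1 *: p.

Lemma mink_minv p : mink p p != 0 -> mink (minv p) (minv p) = (mink p p)^-1.
Proof. by move=> p0; rewrite minkZl minkZr mulVf ?mulr1. Qed.

Lemma minvK p : mink p p != 0 -> minv (minv p) = p.
Proof.
by move=> p0; rewrite {1}/minv mink_minv // invrK scalerA divff // scale1r.
Qed.

End Algebra.

(** * Differential calculus of maps into Minkowski 3-space *)

Section Calculus.
Context {R : realType} {V : normedModType R}.
Implicit Types (p q : V -> 'rV[R]_3) (u v w : V) (U : set V).

Lemma is_derive_coord n (f : V -> 'rV[R]_n) u v j : differentiable f u ->
  is_derive u v (fun z => f z 0 j) (('D_v f u) 0 j).
Proof.
move=> df; rewrite -derive_coord //; apply/derivableP/diff_derivable.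
by move: j; apply/differentiable_rVP.
Qed.

Lemma Ck_on_mink k U p q : open U -> Ck_on k U p -> Ck_on k U q ->
  Ck_on k U (fun z => mink (p z) (q z)).
Proof.
move=> Uo /(Ck_on_rVP _ _ Uo) Cp /(Ck_on_rVP _ _ Uo) Cq.
have C j := Ck_onM Uo (Cp j) (Cq j).
have CN := Ck_onM Uo (Ck_on_cst k U (-1 : R)) (C 2%:R).
apply: (Ck_on_eq Uo _ (Ck_onD Uo (Ck_onD Uo (C 0) (C 1)) CN)) => z _.
by rewrite /mink mulN1r.
Qed.

Lemma Ck_onZl n k U (g : V -> R) (f : V -> 'rV[R]_n) : open U ->
  Ck_on k U g -> Ck_on k U f -> Ck_on k U (fun z => g z *: f z).
Proof.
move=> Uo Cg /(Ck_on_rVP _ _ Uo) Cf; apply/(Ck_on_rVP _ _ Uo) => j.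
by apply: (Ck_on_eq Uo _ (Ck_onM Uo Cg (Cf j))) => z _; rewrite mxE.
Qed.

Lemma Ck_on_minv k U q : open U -> (forall z, U z -> mink (q z) (q z) != 0) ->
  Ck_on k U q -> Ck_on k U (fun z => minv (q z)).
Proof.
move=> Uo q0 Cq; apply: Ck_onZl => //; apply: Ck_onV => //.
exact: Ck_on_mink.
Qed.

Lemma Ck2_differentiable (W : normedModType R) U (f : V -> W) u : Ck_on 2 U f -> U u ->
  differentiable f u /\ forall v, differentiable ('D_v f) u.
Proof.
move=> [df Df] Uu; split=> [|v]; first exact: df.
by have [+ _] := Df v; apply.
Qed.

(** Where [g] and its first derivatives vanish, only the term with both derivatives on [g] survives:
    a factor [h] merely rescales the Hessian of [g]. *)
Lemma second_derive_prod U (g h : V -> R) u v w : open U -> U u ->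
  Ck_on 2 U g -> Ck_on 2 U h ->
  g u = 0 -> 'D_v g u = 0 -> 'D_w g u = 0 ->
  'D_w ('D_v (fun z => g z * h z)) u = 'D_w ('D_v g) u * h u.
Proof.
move=> Uo Uu Cg Ch g0 gv gw.
have : \near u, 'D_v (fun z => g z * h z) u = g u * 'D_v h u + h u * 'D_v g u.
  have : \forall z \near u, U z by exact: open_nbhs_nbhs.
  apply: filterS => z Uz; rewrite [LHS](deriveM (f := g) (g := h)) //.
    by apply/diff_derivable; have [+ _] := Ck2_differentiable Cg Uz.
  by apply/diff_derivable; have [+ _] := Ck2_differentiable Ch Uz.
move=> /near_eq_derive ->.
have ID (f : V -> R) : differentiable f u -> is_derive u w f ('D_w f u).
  by move=> df; apply/derivableP/diff_derivable.
have [/ID ig /(_ v)/ID igv] := Ck2_differentiable Cg Uu.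
have [/ID ih /(_ v)/ID ihv] := Ck2_differentiable Ch Uu.
rewrite (@derive_val _ _ _ _ _ _ _ (is_deriveD (is_deriveM ig ihv) (is_deriveM ih igv))).
rewrite gv gw g0 !scale0r scaler0 !add0r addr0.
exact: mulrC.
Qed.

End Calculus.

(** * The height function of an inverted surface *)

(** Three separate maps are allowed so that one formula differentiates both the equation of a
    pseudosphere along a surface and its first derivative. *)
Lemma derive_mink_pencil (R : realType) (V : normedModType R)
    (p q r : V -> 'rV[R]_3) (n : 'rV[R]_3) (c : R) (u v : V) :
  differentiable p u -> differentiable q u -> differentiable r u ->
  'D_v (fun z => mink (p z) n - c * mink (q z) (r z)) u =
  mink ('D_v p u) n - c * (mink ('D_v q u) (r u) + mink (q u) ('D_v r u)).
Proof.
move=> dp dq dr; have ip j := is_derive_coord v j dp.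
have iq j := is_derive_coord v j dq; have ir j := is_derive_coord v j dr.
rewrite [LHS]derive_val /mink /GRing.scale /=.
by move: ('D_v p u) ('D_v q u) ('D_v r u) => P Q T; ring.
Qed.

Section HeightOfInversion.
Context {R : realType}.

Lemma smooth_translate (V : normedModType R) (U : set V) (q : V -> 'rV[R]_3) a :
  open U -> smooth_on U q -> smooth_on U (fun z => q z + a).
Proof. by move=> Uo Cq k; apply: Ck_onD => //; exact: Ck_on_cst. Qed.

(* If nu is (Euclidean) orthogonal to a surface at q, the pseudosphere
   <n, y> = C <y, y>, with C = - (q . nu) / <q, q> and n = conormal nu q, is
   tangent to it there; its inverse is the plane <n, y> = C. *)
Definition conormal (nu q : 'rV[R]_3) : 'rV[R]_3 :=
  flip nu - (2 * (dot q nu / mink q q)) *: q.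

Lemma mink_conormal (nu q : 'rV[R]_3) : mink q q != 0 ->
  mink q (conormal nu q) = - dot q nu.
Proof.
by move=> q0; rewrite minkC minkDl mink_flip -scaleNr minkZl; field.
Qed.

(** If the conormal vanishes, pairing it with [q] gives q . nu = 0; its correction term then
    disappears and leaves [flip nu] = 0. *)
Lemma conormal_neq0 (nu q : 'rV[R]_3) : mink q q != 0 -> nu != 0 ->
  conormal nu q != 0.
Proof.
move=> q0; apply: contra_neq => n0; apply: flip_eq0.
have d0 : dot q nu = 0.
  apply/eqP; rewrite -oppr_eq0 -mink_conormal // n0 minkC -(scale0r 0) minkZl.
  by rewrite mul0r.
by move: n0; rewrite /conormal d0 mul0r mulr0 scale0r subr0.
Qed.

Variables (V : normedModType R) (U : set V) (x : V -> 'rV[R]_3).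
Variables (a nu : 'rV[R]_3) (u : V).
Hypotheses (Uo : open U) (Cx : smooth_on U x) (Uu : U u).
Hypothesis x_nonnull : forall z, U z -> mink (x z + a) (x z + a) != 0.

Let q z := x z + a.
Let C := - (dot (q u) nu / mink (q u) (q u)).
Let n := conormal nu (q u).

Let Cq : smooth_on U q. Proof. exact: smooth_translate. Qed.

Let derive_q v z : U z -> 'D_v q z = 'D_v x z.
Proof.
move=> Uz; rewrite [LHS]deriveD ?derive_cst ?addr0 //.
by apply: diff_derivable; have [+ _] := Cx 1; apply.
Qed.

Let dq z : U z -> differentiable q z.
Proof. by have [+ _] := Cq 1; apply. Qed.

Let dDq v z : U z -> differentiable ('D_v q) z.
Proof. by have [_ /(_ v)[+ _]] := Cq 2; apply. Qed.

Let mink_n : mink (q u) n = C * mink (q u) (q u).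
Proof. by rewrite mink_conormal ?x_nonnull // mulNr divfK ?x_nonnull. Qed.

Let nE : n = flip nu + (2 * C) *: q u.
Proof. by rewrite /n /conormal /C mulrN scaleNr. Qed.

(** [g] is the equation of the tangent pseudosphere along the surface, and [f] is the height over
    the inverse plane <n, y> = C, whose Euclidean normal is [flip n]. They differ by the factor
    [I]. *)
Let g z := mink (q z) n - C * mink (q z) (q z).
Let I z := (mink (q z) (q z))^-1.
Let f := height (minv (q u)) (flip n) \o (fun z => minv (q z)).

Let fE z : U z -> g z * I z = f z.
Proof.
move=> Uz; rewrite /f /= /height dotBl !dot_flip !minkZl mink_n.
by rewrite /g /I; field; rewrite !x_nonnull.
Qed.

Let Cg : Ck_on 2 U g.
Proof.
have CM := Ck_on_mink Uo (Cq 2) (Ck_on_cst 2 U n).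
have CN := Ck_onM Uo (Ck_on_cst 2 U (- C)) (Ck_on_mink Uo (Cq 2) (Cq 2)).
by apply: (Ck_on_eq Uo _ (Ck_onD Uo CM CN)) => z _; rewrite mulNr.
Qed.

Let CI : Ck_on 2 U I.
Proof. exact: Ck_onV Uo x_nonnull (Ck_on_mink Uo (Cq 2) (Cq 2)). Qed.

Let derive_g v z : U z ->
  'D_v g z = mink ('D_v q z) n - 2 * C * mink (q z) ('D_v q z).
Proof.
move=> Uz; rewrite derive_mink_pencil; try exact: dq.
by rewrite (minkC ('D_v q z) (q z)); ring.
Qed.

Let derive2_g v w : 'D_w ('D_v g) u = mink ('D_w ('D_v q) u) n
   - 2 * C * (mink ('D_w q u) ('D_v q u) + mink (q u) ('D_w ('D_v q) u)).
Proof.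
have E : \near u, 'D_v g u = mink ('D_v q u) n - 2 * C * mink (q u) ('D_v q u).
  have : \forall z \near u, U z by exact: open_nbhs_nbhs.
  by apply: filterS => z; exact: derive_g.
rewrite (near_eq_derive _ E) derive_mink_pencil //.
- exact: dDq.
- exact: dq.
- exact: dDq.
Qed.

Let g0 : g u = 0.
Proof. by rewrite /g mink_n subrr. Qed.

(** Since n - 2 C q(u) = [flip nu], the derivative of [g] at [u] is the Euclidean product of the
    velocity with [nu]. *)
Let gv v : dot ('D_v x u) nu = 0 -> 'D_v g u = 0.
Proof.
move=> tv; rewrite derive_g // derive_q // nE minkC minkDl mink_flip minkZl tv.
by ring.
Qed.

Lemma height_inversion_critical v :
  dot ('D_v x u) nu = 0 -> 'D_v f u = 0.
Proof.
move=> tv; have E : \near u, g u * I u = f u.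
  have : \forall z \near u, U z by exact: open_nbhs_nbhs.
  by apply: filterS => z; exact: fE.
have [dg _] := Ck2_differentiable Cg Uu; have [dI _] := Ck2_differentiable CI Uu.
rewrite -(near_eq_derive _ E) [LHS](deriveM (f := g) (g := I)) ?g0 ?gv //.
- by rewrite scaler0 scale0r addr0.
- exact: diff_derivable.
- exact: diff_derivable.
Qed.

(** As [g] has a critical zero at [u], the Hessian of f = g I is that of [g] times [I]. In the
    Hessian of [g], second derivatives of [q] pair with n - 2 C q = [flip nu], and the quadratic
    term contributes -2 C <D_w x, D_v x>. *)
Lemma height_inversion_derive2 v w :
  dot ('D_v x u) nu = 0 -> dot ('D_w x u) nu = 0 ->
  'D_w (fun z => 'D_v f z) u = (mink (q u) (q u))^-1 *
    (dot ('D_w ('D_v x) u) nu + 2 * dot (q u) nu / mink (q u) (q u)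
      * mink ('D_w x u) ('D_v x u)).
Proof.
move=> tv tw; have E : \forall z \near u, 'D_v (fun z => g z * I z) z = 'D_v f z.
  have : \forall z \near u, U z by exact: open_nbhs_nbhs.
  apply: filterS => z Uz; apply: near_eq_derive.
  have : \forall z \near z, U z by exact: open_nbhs_nbhs.
  by apply: filterS => y; exact: fE.
rewrite -(near_eq_derive _ E) (second_derive_prod Uo Uu Cg CI g0 (gv tv) (gv tw)).
have E2 : 'D_w ('D_v q) u = 'D_w ('D_v x) u.
  apply: near_eq_derive.
  have : \forall z \near u, U z by exact: open_nbhs_nbhs.
  by apply: filterS => z; exact: derive_q.
rewrite derive2_g E2 (derive_q v Uu) (derive_q w Uu) /I mulrC.
apply: (congr1 ( *%R _)).
rewrite nE (minkC _ (flip nu + _)) minkDl mink_flip minkZl /C.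
move: ('D_w ('D_v x) u) ('D_w x u) ('D_v x u) => X Y Z.
by rewrite (minkC (q u) X); ring.
Qed.

End HeightOfInversion.

(** * The Hessian of the inverted surface in a chart *)

Section Chart.
Context {R : realType}.
Implicit Types (U : set 'rV[R]_2) (x : 'rV[R]_2 -> 'rV[R]_3) (a e : 'rV[R]_3).

Definition chart_normal x u : 'rV[R]_3 :=
  cross ('D_(delta_mx 0 0) x u) ('D_(delta_mx 0 1) x u).

(* Up to a scalar, the Hessian at u of the height function of the Moebius
   inversion of x + a, for a = e / s; it makes sense for s = 0 as well, where
   it is the second fundamental form of x. *)
Definition inversion_form x (s : R) e u : 'M[R]_2 :=
  \matrix_(i, j) (dot ('D_(delta_mx 0 i) ('D_(delta_mx 0 j) x) u) (chart_normal x u)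
    + 2 * s * dot (s *: x u + e) (chart_normal x u)
      / mink (s *: x u + e) (s *: x u + e)
      * mink ('D_(delta_mx 0 i) x u) ('D_(delta_mx 0 j) x u)).

(** Since s x + e = s (x + e / s), the correction carries a factor s^2 above and below. *)
Lemma inversion_form_rescale x (s : R) e u : s != 0 ->
  inversion_form x s e u = inversion_form x 1 (s^-1 *: e) u.
Proof.
move=> s0; apply/matrixP => i j; rewrite !mxE scale1r; congr (_ + _ * _).
have -> : s *: x u + e = s *: (x u + s^-1 *: e).
  by rewrite scalerDr scalerA divff // scale1r.
move: (x u + s^-1 *: e) => q; rewrite dotZl minkZl minkZr !invfM.
(* For a null vector both corrections are 0, by the convention on the inverse of 0. *)
have [-> | Q0] := eqVneq (mink q q) 0; first by rewrite invr0 !mulr0.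
by field; rewrite Q0 s0.
Qed.

Lemma derive_tangent x u v : differentiable x u ->
  'D_v x u = v 0 0 *: 'D_(delta_mx 0 0) x u + v 0 1 *: 'D_(delta_mx 0 1) x u.
Proof.
move=> dx; rewrite !deriveE // -!linearZ -linearD; congr ('d _ _ _).
apply/rowP => -[[|[|//]] jlt]; rewrite !mxE /= ?mulr0 ?mulr1 ?addr0 ?add0r;
  by congr (v 0 _); exact/val_inj.
Qed.

Lemma dot_chart_normal x u v : differentiable x u ->
  dot ('D_v x u) (chart_normal x u) = 0.
Proof.
move=> dx; rewrite (derive_tangent v dx) /chart_normal.
move: ('D_(delta_mx 0 0) x u) ('D_(delta_mx 0 1) x u) => X Y.
by rewrite dotE !row3E !mxE; ring.
Qed.

Lemma disc_scale (c : R) (H : 'M[R]_2) : disc (c *: H) = c ^+ 2 * disc H.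
Proof. by rewrite /disc !mxE; ring. Qed.

Lemma hessian_height_inversion U x a u : open U -> smooth_on U x -> U u ->
  (forall z, U z -> mink (x z + a) (x z + a) != 0) ->
  hessian (height (minv (x u + a)) (flip (conormal (chart_normal x u) (x u + a)))
    \o (fun z => minv (x z + a))) u =
  (mink (x u + a) (x u + a))^-1 *: inversion_form x 1 a u.
Proof.
move=> Uo Cx Uu xa; apply/matrixP => i j.
have dx : differentiable x u by have [+ _] := Cx 1; apply.
rewrite mxE (height_inversion_derive2 Uo Cx Uu xa); try exact: dot_chart_normal.
by rewrite !mxE scale1r mulr1.
Qed.

End Chart.

(** * Tangent planes and contact in a parametrization *)

Section Transport.
Context {R : realType}.
Implicit Types (S : set 'rV[R]_3) (U : set 'rV[R]_2) (x : 'rV[R]_2 -> 'rV[R]_3).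

Lemma Ck_on_line (V W : normedModType R) (k : nat) (U : set V) (I : set R^o)
    (f : V -> W) (u v : V) : (forall t, I t -> U (u + t *: v)) ->
  Ck_on k U f -> Ck_on k I (fun t : R^o => f (u + t *: v)).
Proof.
move=> IU; have dl (t : R^o) : differentiable (fun t : R^o => u + t *: v) t.
  by apply: differentiableD; [exact: differentiable_cst|exact: differentiableZl].
elim: k f => [|k IH] f.
  move=> cf t It; apply: (@continuous_comp _ _ _ (fun t : R^o => u + t *: v) f).
    exact: differentiable_continuous.
  exact/cf/IU.
move=> [df Df]; split=> [t It|s].
  apply: (@differentiable_comp _ _ _ _ (fun t : R^o => u + t *: v) f) => //.
  exact/df/IU.
have -> : 'D_s (fun t : R^o => f (u + t *: v)) = fun t => 'D_(s *: v) f (u + t *: v).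
  apply/funext => t; rewrite /derive.
  have -> // : (fun h : R => h^-1 *: (f (u + (h *: s + t) *: v) - f (u + t *: v))) =
    (fun h : R => h^-1 *: (f (h *: (s *: v) + (u + t *: v)) - f (u + t *: v))).
  by apply/funext => h; rewrite scalerDl -scalerA addrCA.
exact: (IH _ (Df (s *: v))).
Qed.

Lemma parametrization_sub S U x u : local_parametrization S U x -> U u -> S (x u).
Proof.
move=> [Uo _ _ _ /(_ U Uo)] [//|W _ E] Uu.
by have [] : (S `&` W) (x u) by rewrite -E; exists u.
Qed.

(** The image under [x] of a short segment through [u] in direction [v] is a smooth curve drawn on
    [S]. *)
Lemma tangent_parametrization S U x u v : local_parametrization S U x -> U u ->
  tangent_plane S (x u) ('D_v x u).
Proof.
move=> Sx Uu; have [Uo Cx _ _ _] := Sx.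
have : \forall t \near (0 : R), U (u + t *: v).
  have c : {for (0 : R), continuous (fun t : R => u + t *: v)}.
    by apply: cvgD; [exact: cvg_cst|exact: scalel_continuous].
  by apply: c; rewrite scale0r addr0; exact: open_nbhs_nbhs.
move=> /nbhs_ballP[e /= e0 eU]; exists (fun t : R^o => x (u + t *: v)), e.
have IU t : t \in `]-e, e[ -> U (u + t *: v).
  move=> te; apply: eU; rewrite /ball /= sub0r normrN ltr_norml.
  by move: te; rewrite in_itv.
split; first exact: e0.
- by move=> k; exact: (Ck_on_line IU (Cx k)).
- by move=> t /IU Ut; exact: (parametrization_sub Sx Ut).
- by rewrite scale0r addr0.
- have : differentiable x u by have [+ _] := Cx 1; apply.
  move=> dx; rewrite -[in RHS](addr0 u) -(scale0r v); apply: derive_val.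
  by apply: is_derive_line; rewrite scale0r addr0; exact: diff_derivable.
Qed.

(** [w] and the two chart velocities are all orthogonal to [nu], hence coplanar; this dispenses with
    expanding [w] in the basis of velocities. *)
Lemma normal_direction_chart S U x u nu w : local_parametrization S U x -> U u ->
  normal_direction S (x u) nu -> tangent_plane S (x u) w ->
  dot w (chart_normal x u) = 0.
Proof.
move=> Sx Uu [nu0 nuS] Tw; apply: (coplanar_cross nu0); last exact: nuS.
- exact/nuS/(tangent_parametrization _ Sx Uu).
- exact/nuS/(tangent_parametrization _ Sx Uu).
Qed.

(** If the cross product vanishes, X and Y are parallel and -Y_k X + X_k Y = 0 for every k.
    Injectivity of the differential gives X_k = 0 for all k, so X = 0, which contradicts injectivity
    again. *)
Lemma chart_normal_neq0 S U x u : local_parametrization S U x -> U u ->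
  chart_normal x u != 0.
Proof.
move=> [Uo Cx dx_inj _ _] Uu; apply/eqP => nu0.
have dx : differentiable x u by have [+ _] := Cx 1; apply.
pose X := 'D_(delta_mx 0 0) x u; pose Y := 'D_(delta_mx 0 1) x u.
have [c0 [c1 c2]] : X 0 1 * Y 0 2%:R = X 0 2%:R * Y 0 1 /\
   X 0 2%:R * Y 0 0 = X 0 0 * Y 0 2%:R /\ X 0 0 * Y 0 1 = X 0 1 * Y 0 0.
  split; last split; apply/eqP; rewrite -subr_eq0; apply/eqP.
  - by have := congr1 (fun w : 'rV[R]_3 => w 0 0) nu0; rewrite row3E mxE.
  - by have := congr1 (fun w : 'rV[R]_3 => w 0 1) nu0; rewrite row3E mxE.
  - by have := congr1 (fun w : 'rV[R]_3 => w 0 2%:R) nu0; rewrite row3E mxE.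
have ker v : 'D_v x u = 0 -> v = 0.
  by move=> Dv; apply: (dx_inj u Uu); rewrite linear0 -deriveE.
have X0 k : X 0 k = 0.
  have /ker : 'D_(row2 (- Y 0 k) (X 0 k)) x u = 0.
    rewrite derive_tangent // -/X -/Y [X in X *: _]mxE [X in _ + X *: _]mxE /=.
    apply: proportional_combination => i.
    by move: k i; do 2!apply: forall_I3; rewrite ?c0 ?c1 ?c2 // -?c0 -?c1 -?c2.
  by move=> /rowP /(_ 1); rewrite !mxE.
have /ker /rowP /(_ 0) : X = 0 by apply/rowP => k; rewrite mxE.
by rewrite !mxE /= => /eqP; rewrite oner_eq0.
Qed.

Lemma derive_height (V : normedModType R) (y : V -> 'rV[R]_3) p nu z v :
  differentiable y z -> 'D_v (height p nu \o y) z = dot ('D_v y z) nu.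
Proof.
move=> dy; have id j := is_derive_coord v j dy.
have -> : height p nu \o y = fun z => mink (flip nu) (y z) - dot p nu.
  by apply/funext => w; rewrite /= /height dotBl mink_flip.
by rewrite [LHS]derive_val -[RHS]mink_flip /mink /GRing.scale /=; ring.
Qed.

(** At s = 0 the form is the second fundamental form along the chart normal, and [nu] is parallel to
    that normal. The Hessian of the height is therefore proportional to the form, and discriminants
    change by squares. *)
Lemma disc_of_contact S U x u nu e : local_parametrization S U x -> U u ->
  normal_direction S (x u) nu ->
  morse_singularity (height (x u) nu \o x) u 0 \/
  morse_singularity (height (x u) nu \o x) u 2 ->
  0 < disc (inversion_form x 0 e u).
Proof.
move=> Sx Uu nuS M; have [Uo Cx _ _ _] := Sx.
have [nu0 nuT] := nuS.
set f := _ \o x in M.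
have fE z : f z = mink (flip nu) (x z) + - mink (flip nu) (x u).
  by rewrite /f /= /height dotBl !mink_flip.
have Cf : Ck_on 2 U f.
  rewrite (funext fE); apply: Ck_onD => //; last exact: Ck_on_cst.
  exact: Ck_on_mink (Ck_on_cst _ _ _) (Cx 2).
have Df v z : U z -> 'D_v f z = dot ('D_v x z) nu.
  by move=> Uz; apply: derive_height; have [+ _] := Cx 1; apply.
have DDf v w : 'D_w ('D_v f) u = dot ('D_w ('D_v x) u) nu.
  have E : \near u, 'D_v f u = (height 0 nu \o 'D_v x) u.
    have : \forall z \near u, U z by exact: open_nbhs_nbhs.
    by apply: filterS => z Uz; rewrite Df //= /height subr0.
  rewrite (near_eq_derive _ E); apply: derive_height.
  by have [_ /(_ v)[+ _]] := Cx 2; apply.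
have [HU HI] : hessian f u \in unitmx /\
    (has_index (hessian f u) 0 \/ has_index (hessian f u) 2).
  by case: M => -[_ HU HI]; split=> //; [left|right].
(* The index sees only the symmetric part of the Hessian and invertibility sees all of it; Schwarz
   ties the two. *)
have Hs : hessian f u 0 1 = hessian f u 1 0.
  by rewrite !mxE; exact: (Schwarz _ _ Uo Uu Cf).
have d0 := disc_gt0_of_index Hs HU HI.
set c := chart_normal x u.
have cc : dot c c != 0 by rewrite dot_self_eq0 (chart_normal_neq0 Sx Uu).
have HK : dot c c *: hessian f u = dot c nu *: inversion_form x 0 e u.
  apply/matrixP => i j; rewrite [LHS]mxE [RHS]mxE [hessian _ _ _ _]mxE DDf.
  rewrite [inversion_form _ _ _ _ _ _]mxE mulr0 !mul0r addr0.
  by apply: dot_normal; exact/nuT/(tangent_parametrization _ Sx Uu).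
have := congr1 (@disc R) HK; rewrite !disc_scale => E.
have : 0 < dot c c ^+ 2 * disc (hessian f u).
  by rewrite mulr_gt0 // exprn_even_gt0.
rewrite E; have [->|cn] := eqVneq (dot c nu) 0; first by rewrite expr0n mul0r ltxx.
by rewrite pmulr_rgt0 // exprn_even_gt0.
Qed.

End Transport.

(** * Inversion of a closed surface *)

Section Inversion.
Context {R : realType}.
Implicit Types (p : 'rV[R]_3).

Lemma Ck_on_id (V : normedModType R) (k : nat) (U : set V) : Ck_on k U (@id V).
Proof.
case: k => [|k]; first by move=> u _; exact: cvg_id.
split=> [u _|v]; first by [].
have -> : 'D_v (@id V) = fun=> v by apply/funext => u; exact: derive_id.
exact: Ck_on_cst.
Qed.

Lemma differentiable_mink p : differentiable (fun q : 'rV[R]_3 => mink q q) p.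
Proof.
have [+ _] := Ck_on_mink openT (Ck_on_id 1 setT) (Ck_on_id 1 [set: 'rV[R]_3]).
exact.
Qed.

Lemma open_nonnull : open [set p : 'rV[R]_3 | mink p p != 0].
Proof.
apply: (@open_comp _ _ (fun p : 'rV[R]_3 => mink p p) [set t | t != 0]).
  by move=> p _; exact/differentiable_continuous/differentiable_mink.
exact: open_neq.
Qed.

Lemma differentiable_minv p : mink p p != 0 -> differentiable (@minv R) p.
Proof.
have [+ _] := Ck_on_minv open_nonnull (fun _ => id) (Ck_on_id 1 _).
exact.
Qed.

Variables (S : set 'rV[R]_3) (a : 'rV[R]_3).
Hypothesis S_nonnull : forall p, S p -> mink (p + a) (p + a) != 0.

Let phi p := minv (p + a).

Lemma continuous_minv_translate p : mink (p + a) (p + a) != 0 -> {for p, continuous phi}.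
Proof.
move=> p0; apply: (@continuous_comp _ _ _ (fun p => p + a) (@minv R)).
  exact: (Ck_onD openT (Ck_on_id 0 setT) (Ck_on_cst 0 setT a) p Logic.I).
exact: (differentiable_continuous (differentiable_minv p0)).
Qed.

Lemma within_continuous_minv_translate : {within S, continuous phi}.
Proof.
apply: continuous_in_subspaceT => p; rewrite inE => Sp.
exact/continuous_minv_translate/S_nonnull.
Qed.

(** The translated surface misses the light cone, so no point is removed, and the continuous image
    of a compact set is already closed. *)
Lemma moebius_inversion_compact : compact S ->
  moebius_inversion (translation a @` S) = phi @` S.
Proof.
move=> Sc; have -> : moebius_inversion (translation a @` S) = closure (phi @` S).
  congr closure; apply/seteqP; split=> [_ [_ [[p Sp <-] _] <-]|_ [p Sp <-]].
    by exists p.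
  exists (p + a) => //; split; first by exists p.
  by move=> /eqP; rewrite (negPf (S_nonnull Sp)).
apply/esym; rewrite -closure_id; apply: compact_closed.
  exact: norm_hausdorff.
by apply: continuous_compact => //; exact: within_continuous_minv_translate.
Qed.

(** Everything is transported by the map y -> [minv y - a], which undoes [phi] on [S] and is smooth
    off the light cone: the chain rule gives injectivity of the differential, and preimages give
    relatively open images. *)
Lemma inversion_parametrization U x : local_parametrization S U x ->
  local_parametrization (phi @` S) U (phi \o x).
Proof.
move=> Sx; have [Uo Cx dx_inj x_inj xO] := Sx.
have x0 z : U z -> mink (x z + a) (x z + a) != 0.
  by move=> Uz; apply: S_nonnull; exact: parametrization_sub Sx Uz.
have Cy : smooth_on U (phi \o x).
  by move=> k; apply: Ck_on_minv => //; exact: smooth_translate.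
have phiK z : U z -> minv ((phi \o x) z) - a = x z.
  by move=> Uz; rewrite /phi /= minvK ?x0 // addrK.
split; [exact: Uo|exact: Cy| | |].
- move=> u Uu v w E; apply: (dx_inj u Uu).
  have dx : differentiable x u by have [+ _] := Cx 1; apply.
  have dy : differentiable (phi \o x) u by have [+ _] := Cy 1; apply.
  have y0 : mink ((phi \o x) u) ((phi \o x) u) != 0.
    by rewrite mink_minv ?invr_eq0 ?x0.
  have dm := differentiable_minv y0.
  have D h : 'd x u h = 'd (@minv R) ((phi \o x) u) ('d (phi \o x) u h).
    rewrite -[LHS]deriveE //.
    have N : \near u, (@minv R \o (phi \o x)) u + - a = x u.
      have : \forall z \near u, U z by exact: open_nbhs_nbhs.
      by apply: filterS => z; exact: phiK.
    rewrite -(near_eq_derive _ N).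
    have dmy : differentiable (@minv R \o (phi \o x)) u by exact: differentiable_comp.
    rewrite [LHS]deriveD ?derive_cst ?addr0 //; last exact: diff_derivable.
    rewrite (deriveE h dmy).
    exact: (congr1 (fun F => F h) (diff_comp dy dm)).
  exact: etrans (D v) (etrans (congr1 _ E) (esym (D w))).
- move=> u v Uu Uv E; apply: x_inj => //.
  by rewrite -[LHS]phiK -?[RHS]phiK ?E // -inE.
- move=> O Oo OU; have [W Wo xW] := xO O Oo OU.
  (* Removing the light cone leaves only points where the inverse map is continuous, so that the
     preimage of [W] is open. *)
  exists ([set p | mink p p != 0] `&` (fun p => minv p - a) @^-1` W).
    rewrite openE => p [p0 Wp]; apply: filterI.
      by apply: open_nbhs_nbhs; split=> //; exact: open_nonnull.
    have c : {for p, continuous (fun p : 'rV[R]_3 => minv p - a)}.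
      exact: (differentiable_continuous (differentiableB (differentiable_minv p0)
        (differentiable_cst a p))).
    by apply: c; exact: open_nbhs_nbhs.
  apply/seteqP; split=> [_ [z Oz <-]|_ [[p Sp <-] [_ Wp]]].
    have : (S `&` W) (x z) by rewrite -xW; exists z.
    move=> [Sxz Wxz]; have p0 := S_nonnull Sxz.
    split; first by exists (x z).
    by split; rewrite /= /phi /= ?minvK ?addrK // mink_minv ?invr_eq0.
  have : (S `&` W) p.
    by split=> //; move: Wp; rewrite /= /phi minvK ?addrK // S_nonnull.
  by rewrite -xW => -[z Oz <-]; exists z.
Qed.

(** A curve on the inverted surface pulls back to a curve on [S], whose velocity is orthogonal to
    [nu]. Applying [height_inversion_critical] to this curve, with the real line as parameter space,
    shows that the original velocity is orthogonal to the new normal. *)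
Lemma inversion_normal p nu : S p -> nu != 0 ->
  (forall w, tangent_plane S p w -> dot w nu = 0) ->
  normal_direction (phi @` S) (phi p) (flip (conormal nu (p + a))).
Proof.
move=> Sp nu0 nuT; split.
  apply: contra_neq (conormal_neq0 (S_nonnull Sp) nu0); exact: flip_eq0.
move=> _ [c [e [e0 Cc cS c0 <-]]].
set I := [set` `]-e, e[ ] : set R^o.
have Io : open I by exact: itv_open.
have I0 : I 0 by rewrite /I /= in_itv /= oppr_lt0 e0.
have cP t : I t -> exists2 q, S q & minv (q + a) = c t by move=> /cS.
pose x t := minv (c t) - a.
have xE t : I t -> S (x t) /\ minv (x t + a) = c t.
  move=> /cP[q Sq E]; rewrite /x subrK -E minvK ?S_nonnull //.
  by rewrite addrK.
have cnull t : I t -> mink (c t) (c t) != 0.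
  by move=> /cP[q Sq <-]; rewrite mink_minv ?invr_eq0 ?S_nonnull.
have Cx : smooth_on I x.
  by apply: smooth_translate => // k; exact: Ck_on_minv.
have x0 : x 0 = p by rewrite /x c0 /phi minvK ?addrK ?S_nonnull.
have xnull t : I t -> mink (x t + a) (x t + a) != 0.
  by move=> /xE[/S_nonnull].
have tx : dot ('D_1 x 0) nu = 0.
  by apply: nuT; exists x, e; split=> // t /xE[].
set f := height (phi p) (flip (conormal nu (p + a))).
have N : \forall t \near (0 : R^o), (f \o (fun z => minv (x z + a))) t = (f \o c) t.
  by apply: filterS (open_nbhs_nbhs (conj Io I0)) => t /xE[_ E] /=; rewrite E.
rewrite -(@derive_height _ _ _ (phi p)); last by have [+ _] := Cc 1; apply.
rewrite -(near_eq_derive (1 : R^o) N).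
by have := height_inversion_critical Io Cx I0 xnull tx; rewrite x0.
Qed.

(** The contact of [S] supplies a normal direction, which makes the chart normal orthogonal to all
    tangent vectors. The new Hessian is a nonzero multiple of the form, so its discriminant is
    positive and its index is 0 or 2. *)
Lemma inversion_contact U x u : local_parametrization S U x -> U u ->
  contact_A1plus S (x u) -> 0 < disc (inversion_form x 1 a u) ->
  contact_A1plus (phi @` S) (phi (x u)).
Proof.
move=> Sx Uu [nu nuS _] d0; have [Uo Cx _ _ _] := Sx.
have x0 z : U z -> mink (x z + a) (x z + a) != 0.
  by move=> Uz; apply: S_nonnull; exact: parametrization_sub Sx Uz.
exists (flip (conormal (chart_normal x u) (x u + a))).
  apply: inversion_normal; first exact: parametrization_sub Sx Uu.
    exact: chart_normal_neq0 Sx Uu.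
  by move=> w; exact: normal_direction_chart Sx Uu nuS.
set f := height _ _.
have crit v : 'D_v (f \o (phi \o x)) u = 0.
  apply: (height_inversion_critical Uo Cx Uu x0); apply: dot_chart_normal.
  by have [+ _] := Cx 1; apply.
have HE : hessian (f \o (phi \o x)) u =
    (mink (x u + a) (x u + a))^-1 *: inversion_form x 1 a u.
  exact: (hessian_height_inversion Uo Cx Uu x0).
have : 0 < disc (hessian (f \o (phi \o x)) u).
  by rewrite HE disc_scale mulr_gt0 // exprn_even_gt0 // invr_eq0 x0.
move=> /index_of_disc_gt0[Hu [Hi|Hi]]; [left|right];
  by exists U, (phi \o x), u; split=> //; exact: inversion_parametrization.
Qed.

Lemma inversion_ovaloid : ovaloid S ->
  (forall p, S p -> exists U x u, [/\ local_parametrization S U x, U u, x u = p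
     & 0 < disc (inversion_form x 1 a u)]) ->
  ovaloid (moebius_inversion (translation a @` S)).
Proof.
move=> [[Sreg Sn0 Sc Sconn] Scont] Sdisc; rewrite moebius_inversion_compact //.
split; [split|].
- move=> _ [p /Sreg[U [x [Sx [u Uu <-]]]] <-].
  exists U, (phi \o x); split; first exact: inversion_parametrization.
  by exists u.
- by have [p Sp] := Sn0; exists (phi p), p.
- by apply: continuous_compact => //; exact: within_continuous_minv_translate.
- apply: connected_continuous_connected => //.
  exact: within_continuous_minv_translate.
- move=> _ [p Sp <-]; have [U [x [u [Sx Uu xu d0]]]] := Sdisc p Sp.
  by rewrite -xu; apply: inversion_contact Sx Uu _ d0; rewrite xu; exact: Scont.
Qed.

End Inversion.

(** * Uniformity on a compact surface *)

Section Continuity.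
Context {R : realType} {T : topologicalType}.
Implicit Types (t : T) (p q : T -> 'rV[R]_3) (c d : T -> R).

Lemma continuous_mink p q t : {for t, continuous p} -> {for t, continuous q} ->
  {for t, continuous (fun z => mink (p z) (q z))}.
Proof.
move=> /continuous_rVP cp /continuous_rVP cq.
have c j : {for t, continuous (fun z => p z 0 j * q z 0 j)}.
  by apply: cvgM; [exact: cp|exact: cq].
by apply: cvgB; [apply: cvgD|]; exact: c.
Qed.

Lemma continuous_dot p q t : {for t, continuous p} -> {for t, continuous q} ->
  {for t, continuous (fun z => dot (p z) (q z))}.
Proof.
move=> /continuous_rVP cp /continuous_rVP cq.
have c j : {for t, continuous (fun z => p z 0 j * q z 0 j)}.
  by apply: cvgM; [exact: cp|exact: cq].
have -> : (fun z => dot (p z) (q z)) = fun z =>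
    p z 0 0 * q z 0 0 + p z 0 1 * q z 0 1 + p z 0 2%:R * q z 0 2%:R.
  by apply/funext => z; rewrite dotE.
by apply: cvgD; [apply: cvgD|]; exact: c.
Qed.

Lemma continuous_cross p q t : {for t, continuous p} -> {for t, continuous q} ->
  {for t, continuous (fun z => cross (p z) (q z))}.
Proof.
move=> /continuous_rVP cp /continuous_rVP cq; apply/continuous_rVP.
have c i j : {for t, continuous (fun z => p z 0 i * q z 0 j)}.
  by apply: cvgM; [exact: cp|exact: cq].
have cB i j k l : {for t, continuous (fun z => p z 0 i * q z 0 j - p z 0 k * q z 0 l)}.
  by apply: cvgB; exact: c.
apply: forall_I3.
- have -> : (fun z => cross (p z) (q z) 0 0) =
    fun z => p z 0 1 * q z 0 2%:R - p z 0 2%:R * q z 0 1.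
    by apply/funext => z; rewrite row3E.
  exact: cB.
- have -> : (fun z => cross (p z) (q z) 0 1) =
    fun z => p z 0 2%:R * q z 0 0 - p z 0 0 * q z 0 2%:R.
    by apply/funext => z; rewrite row3E.
  exact: cB.
- have -> : (fun z => cross (p z) (q z) 0 2%:R) =
    fun z => p z 0 0 * q z 0 1 - p z 0 1 * q z 0 0.
    by apply/funext => z; rewrite row3E.
  exact: cB.
Qed.

Lemma continuous_homothety p c e t : {for t, continuous p} -> {for t, continuous c} ->
  {for t, continuous (fun z => c z *: p z + e)}.
Proof.
by move=> cp cc; apply: cvgD; [exact: cvgZ|exact: cvg_cst].
Qed.

Lemma continuous_disc (H : T -> 'M[R]_2) t :
  (forall i j, {for t, continuous (fun z => H z i j)}) ->
  {for t, continuous (fun z => disc (H z))}.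
Proof.
move=> cH; apply: cvgB.
  by apply: cvgM; [exact: cvg_cst|apply: cvgM; exact: cH].
apply: (@cvgM _ _ _ _ (fun z => H z 0 1 + H z 1 0) (fun z => H z 0 1 + H z 1 0));
  by apply: cvgD; exact: cH.
Qed.

End Continuity.

Section Compactness.
Context {R : realType}.
Implicit Types (U : set 'rV[R]_2) (x : 'rV[R]_2 -> 'rV[R]_3) (e : 'rV[R]_3).

(** The only denominator equals <e, e> at s = 0, and this is nonzero. *)
Lemma continuous_inversion_form U x (u : 'rV[R]_2) e : smooth_on U x -> U u ->
  mink e e != 0 -> forall i j,
  {for (u, 0), continuous (fun z : 'rV[R]_2 * R => inversion_form x z.2 e z.1 i j)}.
Proof.
move=> Cx Uu e0 i j.
have cfst (f : 'rV[R]_2 -> 'rV[R]_3) : {for u, continuous f} ->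
    {for (u, 0 : R), continuous (fun z : 'rV[R]_2 * R => f z.1)}.
  move=> cf; apply: (@continuous_comp _ _ _ (@fst _ R) f); last exact: cf.
  exact: cvg_fst.
have csnd : {for (u, 0 : R), continuous (fun z : 'rV[R]_2 * R => z.2)} by exact: cvg_snd.
have cD v : {for u, continuous ('D_v x)}.
  by have [_ /(_ v)] := Cx 1; apply.
have cDD v w : {for u, continuous ('D_v ('D_w x))}.
  by have [_ /(_ w)[_ /(_ v)]] := Cx 2; apply.
have cnu : {for (u, 0 : R), continuous (fun z : 'rV[R]_2 * R => chart_normal x z.1)}.
  by apply: continuous_cross; apply: (cfst _ (cD _)).
have cq : {for (u, 0 : R), continuous (fun z : 'rV[R]_2 * R => z.2 *: x z.1 + e)}.
  by apply: continuous_homothety csnd; apply: cfst; exact: (Cx 0%N u Uu).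
have -> : (fun z : 'rV[R]_2 * R => inversion_form x z.2 e z.1 i j) =
  (fun z => dot ('D_(delta_mx 0 i) ('D_(delta_mx 0 j) x) z.1) (chart_normal x z.1)
    + 2 * z.2 * dot (z.2 *: x z.1 + e) (chart_normal x z.1)
      * (mink (z.2 *: x z.1 + e) (z.2 *: x z.1 + e))^-1
      * mink ('D_(delta_mx 0 i) x z.1) ('D_(delta_mx 0 j) x z.1)).
  by apply/funext => z; rewrite mxE.
have h1 := continuous_dot (cfst _ (cDD (delta_mx 0 i) (delta_mx 0 j))) cnu.
have h2 := continuous_dot cq cnu.
have h3 := continuous_mink cq cq.
have h4 := continuous_mink (cfst _ (cD (delta_mx 0 i))) (cfst _ (cD (delta_mx 0 j))).
apply: (cvgD h1); apply: cvgM h4; apply: cvgM; last first.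
  by apply: cvgV h3; rewrite /= scale0r add0r.
by apply: cvgM h2; apply: cvgM; [exact: cvg_cst|exact: csnd].
Qed.

(** Positivity of the discriminant persists near (u, 0). Since [x] maps open sets to relatively open
    subsets of [S], a neighbourhood of [u] in the parameters becomes one of [x u] in [S]. *)
Lemma inversion_disc_near (S : set 'rV[R]_3) U x (u : 'rV[R]_2) e :
  local_parametrization S U x -> U u -> mink e e != 0 ->
  0 < disc (inversion_form x 0 e u) ->
  \forall p \near x u & s \near (0 : R), S p ->
    mink (s *: p + e) (s *: p + e) != 0 /\
    exists v, [/\ U v, x v = p & 0 < disc (inversion_form x s e v)].
Proof.
move=> Sx Uu e0 d0; have [Uo Cx _ _ xO] := Sx.
have cdisc := continuous_disc (continuous_inversion_form Cx Uu e0).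
have [[A B] /= [uA sB] AB] : nbhs (u, 0 : R)
    [set z : 'rV[R]_2 * R | 0 < disc (inversion_form x z.2 e z.1)].
  apply: (cdisc [set t | 0 < t]); apply: open_nbhs_nbhs.
  by split; [exact: open_gt|exact: d0].
have cnull : {for (x u, 0 : R), continuous (fun z : 'rV[R]_3 * R =>
    mink (z.2 *: z.1 + e) (z.2 *: z.1 + e))}.
  have c : {for (x u, 0 : R), continuous (fun z : 'rV[R]_3 * R => z.2 *: z.1 + e)}.
    by apply: continuous_homothety; [exact: cvg_fst|exact: cvg_snd].
  exact: continuous_mink.
have null : \forall p \near x u & s \near (0 : R), mink (s *: p + e) (s *: p + e) != 0.
  apply: (cnull [set t | t != 0]); apply: open_nbhs_nbhs; split; first exact: open_neq.
  by rewrite /= scale0r add0r.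
(* The chart condition concerns open sets, hence the interior of [A]. *)
have [W Wo xW] := xO (U `&` A°) (openI Uo (@open_interior _ A)) (@subIsetl _ _ _).
have Wx : W (x u).
  have : (S `&` W) (x u) by rewrite -xW; exists u.
  by case.
have : \forall p \near x u & s \near (0 : R), W p /\ B s.
  exists (W, B); first by split=> //; exact: open_nbhs_nbhs.
  by case=> p s [].
apply: filterS2 null => -[p s] /= pn [Wp Bs] Sp; split=> //.
have : (S `&` W) p by [].
rewrite -xW => -[v [Uv Av] xv]; exists v; split; [exact: Uv|exact: xv|].
exact: (AB (v, s) (conj (interior_subset Av) Bs)).
Qed.

End Compactness.

(** * Choice of the translation by compactness *)

Theorem theorem4p6 (R : realType) (S : set 'rV[R]_3) (hS : ovaloid S) :
  exists a : 'rV[R]_3, ovaloid (moebius_inversion (translation a @` S)).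
Proof.
have [[Sreg _ Sc _] Scont] := hS.
(* Any non-null direction would do; this one has <e, e> = 1. *)
pose e : 'rV[R]_3 := row3 1 0 0.
have e0 : mink e e != 0.
  by rewrite /mink !row3E mulr1 !mulr0 addr0 subr0 oner_eq0.
pose P s p := mink (s *: p + e) (s *: p + e) != 0 /\
  exists U x u, [/\ local_parametrization S U x, U u, x u = p
    & 0 < disc (inversion_form x s e u)].
have near_P : \forall s \near (0 : R)^'+, S `<=` P s.
  (* The near-covering form of compactness turns a bound on [s] depending on the point [p] into one
     valid on all of [S]. *)
  have /compact_near_coveringP/near_covering_withinP := Sc; apply=> p Sp.
  have [nu nuS M] := Scont p Sp.
  have [U [x [u [Sx Uu xu d0]]]] : exists U x u, [/\ local_parametrization S U x,
      U u, x u = p & 0 < disc (inversion_form x 0 e u)].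
    case: M => -[U [x [u [Sx Uu xu M]]]]; exists U, x, u; split=> //;
      apply: (@disc_of_contact _ S U x u nu e) => //; rewrite ?xu //.
    - by left.
    - by right.
  have [[A B] /= [pA sB] AB] := inversion_disc_near Sx Uu e0 d0.
  exists (A, B); first by rewrite -xu; split=> //; by apply: filterS sB => t Bt _.
  move=> [q s] [/= Aq Bs] Sq; have [qn [v [Uv xv dv]]] := AB (q, s) (conj Aq Bs) Sq.
  by split=> //; exists U, x, v.
have [s [s0 sP]] := filter_ex (filterI (nbhs_right_gt (0 : R)) near_P).
have s_neq0 : s != 0 by rewrite gt_eqF.
have sE p : s *: p + e = s *: (p + s^-1 *: e).
  by rewrite scalerDr scalerA divff // scale1r.
(* Dividing s p + e by [s] turns its non-nullity into that of p + e / s, and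
   [inversion_form_rescale] turns the form at [s] into the form at 1. *)
exists (s^-1 *: e); apply: inversion_ovaloid => // p /sP[].
  by rewrite sE minkZl minkZr !mulf_eq0 !negb_or => /and3P[].
move=> _ [U [x [u [Sx Uu xu]]]]; rewrite inversion_form_rescale // => d0.
by exists U, x, u.
Qed.
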